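(* Fix $q\in[0,1)$. For $n\in\mathbb{N}$ let $\Pi_n$ be $\pi_{n,q}$-distributed and let $\Pi_\infty$ be a Mallows permutation on $\mathbb{N}$ with parameter $q$. Then $\mathrm{BST}(\Pi_n)$ converges to $\mathrm{BST}(\Pi_\infty)$ in the rooted topology: for every $r\ge1$ and every finite rooted tree $t$, $$\mathbb{P}\big(B_r(\varnothing,\mathrm{BST}(\Pi_n))\equiv t\big)\longrightarrow\mathbb{P}\big(B_r(\varnothing,\mathrm{BST}(\Pi_\infty))\equiv t\big)\quad(n\to\infty).$$
   Context: $\pi_{n,q}(\sigma)=q^{\mathrm{Inv}(\sigma)}/Z_{n,q}$ on $S_n$, $\mathrm{Inv}(\sigma)=|\{i<j:\sigma(i)>\sigma(j)\}|$, $0^0=1$. A Mallows permutation on $\mathbb{N}$ with parameter $q$ is the permutation $(I_1,I_2,\dots)$ of $\mathbb{N}$ where, for independent Bernoulli$(1-q)$ variables $(B_{i,j})_{i,j\ge1}$, $I_i=\min\{j\notin\{I_1,\dots,I_{i-1}\}:B_{i,j}=1\}$. $\mathbb{T}$ is the set of finite words over $\{0,1\}$ with empty word $\varnothing$ (the root), viewed as a graph with edges $\{w,w0\},\{w,w1\}$; $aS=\{aw:w\in S\}$. For a finite sequence $x=(x_1,\dots,x_n)$ of distinct numbers, $\mathrm{BST}(x)=\emptyset$ if $n=0$, else $\{\varnothing\}\cup0\,\mathrm{BST}(x_-)\cup1\,\mathrm{BST}(x_+)$ with $x_-$ (resp. $x_+$) the subsequence of entries smaller (resp. larger) than $x_1$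 in original order; for infinite $x$, $\mathrm{BST}(x)=\bigcup_n\mathrm{BST}(x_1,\dots,x_n)$; $\mathrm{BST}(\sigma)=\mathrm{BST}(\sigma(1),\sigma(2),\dots)$, seen as an induced subgraph of $\mathbb{T}$. $B_r(v,G)$ is the subgraph of $G$ induced by vertices within graph distance $r$ of $v$, rooted at $v$; $\equiv$ is rooted-graph isomorphism. *)

(* Defs.v *)
From HB Require Import structures.
From mathcomp Require Import all_boot all_order all_algebra all_fingroup.
From mathcomp Require Import all_classical all_reals all_analysis.

Set Implicit Arguments.
Unset Strict Implicit.
Unset Printing Implicit Defensive.
Import Order.TTheory GRing.Theory Num.Theory.

(* ---------- Words of T = {0,1}^* : false = 0, true = 1; root = [::] ---------- *)

Definition tadj (u v : seq bool) : bool :=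
  [|| v == rcons u false, v == rcons u true, u == rcons v false | u == rcons v true].

Fixpoint inBST (x : seq nat) (w : seq bool) {struct w} : bool :=
  match x with
  | [::] => false
  | x1 :: xs =>
      match w with
      | [::] => true
      | b :: w' =>
          inBST (if b then [seq y <- xs | (x1 < y)%N] else [seq y <- xs | (y < x1)%N]) w'
      end
  end.

(* BST of an infinite sequence given by its prefixes: union of BST of prefixes *)
Definition BST_inf (pref : nat -> seq nat) : seq bool -> Prop :=
  fun w => exists n, inBST (pref n) w.

Definition BST_perm (n : nat) (s : 'S_n) : seq bool -> Prop :=
  fun w => inBST [seq (s i).+1 | i <- enum 'I_n] w.

Fixpoint within (G : seq bool -> Prop) (k : nat) (v w : seq bool) : Prop :=
  match k with
  | 0 => G v /\ w = v
  | k'.+1 => within G k' v w \/ exists u, within G k' v u /\ G w /\ tadj u w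
  end.

Definition ball (G : seq bool -> Prop) (r : nat) : seq bool -> Prop :=
  fun w => within G r [::] w.

Definition is_tree (V : finType) (e : rel V) : Prop :=
  symmetric e /\ irreflexive e /\ (forall x y, connect e x y) /\
  (forall c : seq V, uniq c -> (2 < size c)%N -> ~~ path.cycle e c).

Definition ball_iso (G : seq bool -> Prop) (r : nat)
    (V : finType) (e : rel V) (v0 : V) : Prop :=
  let H := ball G r in
  exists (f : seq bool -> V) (g : V -> seq bool),
    (forall w, H w -> g (f w) = w) /\
    (forall x, H (g x) /\ f (g x) = x) /\
    f [::] = v0 /\ g v0 = [::] /\
    (forall u w, H u -> H w -> (tadj u w <-> e (f u) (f w))).

Definition Inv (n : nat) (s : 'S_n) : nat :=
  #|[set p : 'I_n * 'I_n | (p.1 < p.2)%N && (s p.2 < s p.1)%N]|.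

Definition mallows_pi {R : realType} (q : R) (n : nat) (s : 'S_n) : R :=
  (q ^+ Inv s / \sum_(s' : 'S_n) q ^+ Inv s')%R.

Definition mallows_prob {R : realType} (q : R) (n : nat) (E : 'S_n -> Prop) : R :=
  (\sum_(s : 'S_n | `[< E s >]) mallows_pi q s)%R.

(* min{ j >= 1 : j \notin used, b j }  (0 if no such j: a null event) *)
Definition mallows_step (used : seq nat) (b : nat -> bool) : nat :=
  match pselect (exists j, [&& (0 < j)%N, j \notin used & b j]) with
  | left h => ex_minn h
  | right _ => 0%N
  end.

Fixpoint mallows_prefix (B : nat -> nat -> bool) (n : nat) : seq nat :=
  match n with
  | 0 => [::]
  | n'.+1 => let s := mallows_prefix B n' in rcons s (mallows_step s (B n'.+1))
  end.

(* Main.v *)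
Require Import Defs.
From HB Require Import structures.
From mathcomp Require Import all_boot all_order all_algebra all_fingroup.
From mathcomp Require Import all_classical all_reals all_analysis.
From mathcomp Require Import zify lra.
Import Order.TTheory GRing.Theory Num.Theory numFieldNormedType.Exports.
Local Open Scope classical_set_scope.

(** Say that a finite sequence [x] of distinct positive integers decides the
    tree up to depth [r] if extending [x] never changes [BST(x)] at depth at
    most [r].  Almost surely every value is hit by [Pi_oo]; then there are
    infinitely many left-to-right maxima, and once all values below the
    [(r+1)]-st one have appeared the prefix is deciding.  Sequences that decide
    and have no deciding proper prefix give disjoint cylinder events, which
    almost surely cover.  The probability that [Pi_n] starts with a fixed [x]
    converges to the one for [Pi_oo], so summing over finitely many minimal
    deciding sequences bounds the lower limit of the probability of any event
    [Q] depending only on depth at most [r]; applying this to [Q] and to its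
    complement gives convergence. *)

(** * Decided prefixes *)

Lemma inBST_cat x y w : inBST x w -> inBST (x ++ y) w.
Proof.
elim: w x y => [|b w IH] [|x1 xs] y //=.
by case: b; rewrite filter_cat; apply: IH.
Qed.

(** Each edge changes the word length by one, which confines a ball of radius [r] around the root to
    depth at most [r]. *)
Lemma size_within G k w : Defs.within G k [::] w -> (size w <= k)%N.
Proof.
elim: k w => [|k IH] w /=; first by case=> _ ->.
case=> [/IH/leqW//|[u [/IH uk [_]]]].
by case/or4P => /eqP E; move: uk; rewrite E size_rcons // => /ltnW/leqW.
Qed.

Definition agree (r : nat) (G G' : seq bool -> Prop) :=
  forall w, (size w <= r)%N -> G w <-> G' w.

Lemma agree_sym r G G' : agree r G G' -> agree r G' G.
Proof. by move=> h w /h []. Qed.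

Lemma within_agree r G G' k w : agree r G G' -> (k <= r)%N ->
  Defs.within G k [::] w -> Defs.within G' k [::] w.
Proof.
move=> GG'; elim: k w => [|k IH] w kr.
  by case=> G0 ->; split=> //; apply/GG'.
move=> H; have := size_within _ _ _ H; case: H => [/IH h _|[u [/IH h [Gw uw]]] wk].
  by left; apply: h; exact: ltnW.
right; exists u; split; first by apply: h; exact: ltnW.
by split=> //; apply/GG' => //; exact: leq_trans wk kr.
Qed.

Lemma ball_iso_agree r G G' (V : finType) (e : rel V) v0 : agree r G G' ->
  ball_iso G r e v0 <-> ball_iso G' r e v0.
Proof.
move=> GG'; suff E : Defs.ball G r = Defs.ball G' r by rewrite /ball_iso E.
apply/funext => w; apply/propext.
split; apply: (@within_agree r) => //; exact: agree_sym.
Qed.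

Definition proper_seq (x : seq nat) := uniq x && all (leq 1) x.

(** Only continuations with distinct positive entries are tested: once all positive values up to [h]
    have appeared, no such continuation brings an entry below [h], and this is what closes off a
    subtree. *)
Definition decides (x : seq nat) (w : seq bool) :=
  forall y, proper_seq (x ++ y) -> inBST (x ++ y) w = inBST x w.

Definition decides_upto (r : nat) (x : seq nat) :=
  forall w, (size w <= r)%N -> decides x w.

Lemma proper_seq_catl x y : proper_seq (x ++ y) -> proper_seq x.
Proof. by rewrite /proper_seq cat_uniq all_cat => /andP[/and3P[-> _ _] /andP[-> _]]. Qed.

Lemma decides_cat x z w : decides x w -> decides (x ++ z) w.
Proof.
move=> xw y; rewrite -catA => pxzy.
rewrite !xw //; apply: (proper_seq_catl _ y); by rewrite -catA.
Qed.

Lemma mallows_prefix_cat B m k :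
  exists y, mallows_prefix B (m + k) = mallows_prefix B m ++ y.
Proof.
elim: k => [|k [y E]]; first by exists [::]; rewrite addn0 cats0.
by rewrite addnS /= {1}E rcons_cat; eexists.
Qed.

Lemma size_mallows_prefix B m : size (mallows_prefix B m) = m.
Proof. by elim: m => //= m IH; rewrite size_rcons IH. Qed.

Lemma mallows_prefix_take B m n : (m <= n)%N ->
  mallows_prefix B m = take m (mallows_prefix B n).
Proof.
move=> /subnKC <-; have [y ->] := mallows_prefix_cat B m (n - m).
by rewrite take_size_cat // size_mallows_prefix.
Qed.

(** The almost sure event on which the construction works: successes in rows make every minimum
    exist, successes in columns make every value appear. *)
Definition good_array (B : nat -> nat -> bool) :=
  (forall i N, (0 < i)%N -> exists2 j, (N < j)%N & B i j) /\
  (forall j N, (0 < j)%N -> exists2 i, (N < i)%N & B i j).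

Lemma mallows_stepP B (x : seq nat) i : good_array B -> (0 < i)%N ->
  let a := mallows_step x (B i) in
  [/\ (0 < a)%N, a \notin x, B i a &
    forall j, (0 < j)%N -> j \notin x -> B i j -> (a <= j)%N].
Proof.
move=> [rowB _] i0 /=; rewrite /mallows_step; case: pselect => [h|[]].
  case: ex_minnP => a /and3P[a0 ax Ba] amin; split=> // j j0 jx Bj.
  by apply: amin; rewrite j0 jx.
have [j Nj Bj] := rowB i (\max_(y <- x) y)%N i0; exists j.
rewrite Bj (leq_ltn_trans _ Nj) // andbT /=; apply/negP => jx.
by move: Nj; rewrite ltnNge (leq_bigmax_seq _ jx).
Qed.

Lemma proper_mallows_prefix B m : good_array B -> proper_seq (mallows_prefix B m).
Proof.
move=> gB; elim: m => //= m; rewrite /proper_seq rcons_uniq all_rcons => /andP[-> ->].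
by have [-> -> _ _] := mallows_stepP B (mallows_prefix B m) m.+1 gB (ltn0Sn m).
Qed.

Lemma mallows_prefix_mem B j : good_array B -> (0 < j)%N ->
  exists m, j \in mallows_prefix B m.
Proof.
(* Each success [B i j] met while [j] is unused consumes a value below [j]. *)
move=> gB j0; apply: contrapT => nj.
have {}nj m : j \notin mallows_prefix B m by apply/negP => ?; apply: nj; exists m.
have step c : exists m, (c <= count (gtn j) (mallows_prefix B m))%N.
  elim: c => [|c [m cm]]; first by exists 0%N.
  have [i mi Bij] := gB.2 j m j0.
  case: i mi Bij => // i mi Bij; exists i.+1.
  have [a0 ax Ba amin] := mallows_stepP B (mallows_prefix B i) i.+1 gB (ltn0Sn i).
  have := amin _ j0 (nj i) Bij; rewrite leq_eqVlt => /orP[/eqP E|aj].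
    by have := nj i.+1; rewrite /= mem_rcons inE E eqxx.
  rewrite /= -cats1 count_cat /= aj.
  have [y] := mallows_prefix_cat B m (i - m); rewrite subnKC // => ->.
  by rewrite count_cat addn0 addn1 ltnS (leq_trans cm) // leq_addr.
have [m] := step j.+1; rewrite -size_filter leqNgt => /negP; apply.
have /andP[um _] := proper_mallows_prefix B m gB.
rewrite ltnS -[X in (_ <= X)%N](size_iota 0); apply: uniq_leq_size.
  exact: filter_uniq.
by move=> y; rewrite mem_filter mem_iota /= add0n => /andP[].
Qed.

Lemma mallows_prefix_sub B (h : nat) : good_array B ->
  exists m, forall j, (0 < j <= h)%N -> j \in mallows_prefix B m.
Proof.
move=> gB; elim: h => [|h [m IH]]; first by exists 0%N; case.
have [m' hm'] := mallows_prefix_mem B h.+1 gB (ltn0Sn h).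
have [y Ey] := mallows_prefix_cat B m m'.
have [y' Ey'] := mallows_prefix_cat B m' m.
exists (m + m')%N => j /andP[j0]; rewrite leq_eqVlt => /orP[/eqP ->|jh].
  by rewrite addnC Ey' mem_cat hm'.
by rewrite Ey mem_cat IH // j0.
Qed.

Lemma filter_lt_nil (x y : seq nat) (a h : nat) :
  (forall j, (0 < j <= h)%N -> j \in x) -> proper_seq (x ++ y) ->
  [seq z <- y | (a < z < h)%N] = [::].
Proof.
move=> hx /andP[]; rewrite cat_uniq all_cat => /and3P[_ /hasPn hy _] /andP[_ /allP y0].
rewrite -(@filter_pred0 _ y); apply: eq_in_filter => z zy.
apply/negbTE/negP => /andP[_ zh]; have /= := hy _ zy.
by rewrite hx //; apply/andP; split; [exact: y0|exact: ltnW].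
Qed.

(** The first entry [h] of [x] above [a] is the root of this subtree whatever follows [x], so the
    next letter selects the entries above [h] or those strictly between [a] and [h]. *)
Lemma inBST_filter_gt (x y t : seq nat) (a h : nat) b w :
  [seq z <- x | (a < z)%N] = h :: t ->
  inBST [seq z <- x ++ y | (a < z)%N] (b :: w) =
  inBST (if b then [seq z <- x ++ y | (h < z)%N]
         else [seq z <- x ++ y | (a < z < h)%N]) w.
Proof.
move=> E.
have ah : (a < h)%N.
  by have : h \in h :: t := mem_head _ _; rewrite -E mem_filter => /andP[].
have filterE (p1 p2 : pred nat) : (forall z, p2 z = p1 z && (a < z)%N) ->
    ~~ p1 h ->
    [seq z <- x ++ y | p2 z] = [seq z <- t ++ [seq z <- y | (a < z)%N] | p1 z].
  move=> p12 /negbTE p1h.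
  have -> : [seq z <- x ++ y | p2 z] = [seq z <- [seq z <- x ++ y | (a < z)%N] | p1 z].
    by rewrite -filter_predI; apply: eq_filter => z /=.
  by rewrite [in LHS]filter_cat E /= p1h.
rewrite filter_cat E /=; congr inBST; case: b; symmetry; apply: filterE.
- by move=> z; case: (ltnP h z) => //= hz; rewrite (ltn_trans ah hz).
- by rewrite /= ltnn.
- by move=> z; rewrite andbC.
- by rewrite /= ltnn.
Qed.

(* Along the word, [a] is the last left-to-right maximum that was passed on the
   right; turning left of the next one, [h], leaves only finitely many values. *)
Lemma mallows_decides_gt B w (a : nat) : good_array B -> exists m, forall y,
  proper_seq (mallows_prefix B m ++ y) ->
  inBST [seq z <- mallows_prefix B m ++ y | (a < z)%N] w =
  inBST [seq z <- mallows_prefix B m | (a < z)%N] w.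
Proof.
move=> gB; elim: w a => [|b w IH] a;
  (* The value [a.+1] appears eventually, so the filtered prefix has a head [h]; this already
     settles the empty word. *)
  have [m0 hm0] := mallows_prefix_mem B a.+1 gB (ltn0Sn a);
  (have : a.+1 \in [seq z <- mallows_prefix B m0 | (a < z)%N]
    by rewrite mem_filter hm0 ltnSn);
  case E : [seq z <- mallows_prefix B m0 | (a < z)%N] => [//|h t] _.
  by exists m0 => y _; rewrite filter_cat E.
have [m hm] : exists m, forall y, proper_seq (mallows_prefix B m ++ y) ->
  let f := fun z => if b then (h < z)%N else (a < z < h)%N in
  inBST [seq z <- mallows_prefix B m ++ y | f z] w =
  inBST [seq z <- mallows_prefix B m | f z] w.
  case: b; first exact: IH.
  have [m hm] := mallows_prefix_sub B h gB; exists m => y py /=.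
  by rewrite filter_cat (filter_lt_nil _ _ a h hm py) cats0.
have [y1 E1] := mallows_prefix_cat B m0 m.
have [y2] := mallows_prefix_cat B m m0; rewrite addnC E1 => E2.
exists (m0 + m)%N => y; rewrite E1 => py; rewrite -catA !(inBST_filter_gt _ _ _ _ _ _ _ E).
(* The prefix of length [m0 + m] extends both the one exhibiting [h] and the one deciding the rest
   [w], so the value is the same with continuation [y] and with none. *)
have C y' : proper_seq (mallows_prefix B m0 ++ y1 ++ y') ->
    inBST (if b then [seq z <- mallows_prefix B m0 ++ y1 ++ y' | (h < z)%N]
         else [seq z <- mallows_prefix B m0 ++ y1 ++ y' | (a < z < h)%N]) w =
    inBST [seq z <- mallows_prefix B m | if b then (h < z)%N else (a < z < h)%N] w.
  by rewrite catA E2 -catA => /hm /= <-; case: b {hm}.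
rewrite C ?catA //; have := C [::]; rewrite cats0 => -> //.
exact: proper_seq_catl _ _ py.
Qed.

Lemma mallows_decides B w : good_array B ->
  exists m, decides (mallows_prefix B m) w.
Proof.
(* The threshold 0 discards nothing, as entries are positive. *)
move=> gB; have [m hm] := mallows_decides_gt B w 0 gB; exists m => y py.
have pos x : proper_seq x -> [seq z <- x | (0 < z)%N] = x.
  by move=> /andP[_ px]; apply/all_filterP.
by have := hm y py; rewrite !pos //; exact: proper_seq_catl _ _ py.
Qed.

Fixpoint words (r : nat) : seq (seq bool) :=
  if r is r'.+1 then
    [::] :: [seq false :: w | w <- words r'] ++ [seq true :: w | w <- words r']
  else [:: [::]].

Lemma mem_words r w : (w \in words r) = (size w <= r)%N.
Proof.
elim: r w => [|r IH] [|b w] //=; rewrite inE /= mem_cat ltnS -IH.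
have inj (c : bool) : injective (cons c) by move=> ? ? [].
have neq c c' : c != c' -> (c :: w \in [seq c' :: w | w <- words r]) = false.
  by move=> cc'; apply/mapP => -[v _ [Ec _]]; rewrite Ec eqxx in cc'.
by case: b; rewrite (mem_map (inj _)) neq ?orbF.
Qed.

Lemma mallows_decides_upto B r : good_array B ->
  exists m, decides_upto r (mallows_prefix B m).
Proof.
move=> gB; have : forall s : seq (seq bool), exists m, forall w, w \in s ->
    decides (mallows_prefix B m) w.
  elim=> [|w s [m IH]]; first by exists 0%N.
  have [m' hm'] := mallows_decides B w gB.
  have [y Ey] := mallows_prefix_cat B m m'.
  have [y' Ey'] := mallows_prefix_cat B m' m.
  exists (m + m')%N => v; rewrite inE => /orP[/eqP ->|/IH h].
    by rewrite addnC Ey'; exact: decides_cat.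
  by rewrite Ey; exact: decides_cat.
move=> /(_ (words r))[m hm]; exists m => w wr; apply: hm; by rewrite mem_words.
Qed.

Lemma agree_BST_inf B r m : good_array B ->
  decides_upto r (mallows_prefix B m) ->
  agree r (BST_inf (mallows_prefix B)) (inBST (mallows_prefix B m)).
Proof.
move=> gB dm w wr; split; last by exists m.
move=> [k kw]; have [y Ey] := mallows_prefix_cat B m k.
have [y' Ey'] := mallows_prefix_cat B k m.
rewrite -(dm w wr y) -Ey; last exact: proper_mallows_prefix.
by rewrite addnC Ey'; exact: inBST_cat.
Qed.

(** * Prefixes of finite Mallows permutations *)

Local Open Scope ring_scope.

Lemma InvE n (s : 'S_n) :
  Defs.Inv s = (\sum_(i < n) \sum_(j < n) ((i < j)%N && (s j < s i)%N))%N.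
Proof.
rewrite /Defs.Inv cardsE -sum1_card pair_big /= big_mkcond /=.
by apply: eq_bigr => -[i j] _; rewrite unfold_in; case: ifP.
Qed.

Lemma sum_ltn_ord n (a : nat) : (\sum_(i < n) (i < a)%N = minn n a)%N.
Proof.
by elim: n => [|n IH]; rewrite ?big_ord0 ?min0n // big_ord_recr /= IH; lia.
Qed.

(** A first entry [a] precedes exactly [a] smaller values, and shifting the other values by [bump a]
    preserves their order. *)
Lemma Inv_lift_perm n (a : 'I_n.+1) (t : 'S_n) :
  Defs.Inv (lift_perm ord0 a t) = (a + Defs.Inv t)%N.
Proof.
rewrite !InvE big_ord_recl; congr (_ + _)%N.
  rewrite big_ord_recl ltnn add0n lift_perm_id.
  under eq_bigr => i _ do rewrite lift_perm_lift.
  (* Summing over values instead of positions leaves the number of values below [a]. *)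
  rewrite (reindex_inj (@perm_inj _ (t^-1)%g)) /=.
  under eq_bigr => i _ do rewrite permKV.
  rewrite -[RHS](minn_idPr (ltn_ord a : (a <= n)%N)) -sum_ltn_ord.
  by apply: eq_bigr => i _; congr nat_of_bool; rewrite /= /bump; case: leqP; lia.
apply: eq_bigr => i _; rewrite big_ord_recl /= add0n.
apply: eq_bigr => j _; rewrite !lift_perm_lift /=; congr nat_of_bool.
by rewrite /bump /=; congr andb; do 2! case: leqP; lia.
Qed.

Lemma sum_perm_lift (R : realType) n (F : 'S_n.+1 -> R) :
  \sum_(s : 'S_n.+1) F s =
  \sum_(a < n.+1) \sum_(t : 'S_n) F (lift_perm ord0 a t).
Proof.
rewrite (partition_big (fun s : 'S_n.+1 => s ord0) xpredT) //=.
apply: eq_bigr => a _; rewrite (reindex (lift_perm ord0 a)).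
  by apply: eq_bigl => t; rewrite lift_perm_id eqxx.
(* [ulsf i s] deletes the entry at position [i] and closes the gap in the values, which inverts
   [lift_perm]. *)
pose ulsf i (s : 'S_n.+1) k := odflt k (unlift (s i) (s (lift i k))).
have ulsfK i (s : 'S_n.+1) k : lift (s i) (ulsf i s k) = s (lift i k).
  rewrite /ulsf; have:= neq_lift i k.
  by rewrite -(can_eq (permK s)) => /unlift_some[] ? ? ->.
have inj_ulsf : injective (ulsf ord0 _).
  move=> s; apply: can_inj (ulsf (s ord0) s^-1%g) _ => k'.
  by rewrite {1}/ulsf ulsfK !permK liftK.
exists (fun s => perm (inj_ulsf s)) => [s _ | s].
  by apply/permP=> k'; rewrite permE /ulsf lift_perm_lift lift_perm_id liftK.
move/(s _ =P _) => si; apply/permP=> k.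
have [k'|] := unliftP ord0 k => ->; rewrite ?lift_perm_id //.
by rewrite lift_perm_lift -si permE ulsfK.
Qed.

Definition mallows_Z {R : realType} (q : R) n : R := \sum_(s : 'S_n) q ^+ Defs.Inv s.

Lemma mallows_Z_gt0 (R : realType) (q : R) n : 0 <= q -> 0 < mallows_Z q n.
Proof.
move=> q0; rewrite /mallows_Z (bigD1 1%g) //= ltr_pwDl //.
  rewrite InvE big1 ?expr0 // => i _; rewrite big1 // => j _.
  by rewrite !perm1; case: ltngtP.
by apply: sumr_ge0 => s _; exact: exprn_ge0.
Qed.

Lemma mallows_Z_rec (R : realType) (q : R) n :
  mallows_Z q n.+1 = (\sum_(a < n.+1) q ^+ a) * mallows_Z q n.
Proof.
rewrite /mallows_Z sum_perm_lift big_distrl /=; apply: eq_bigr => a _.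
by rewrite big_distrr /=; apply: eq_bigr => t _; rewrite Inv_lift_perm exprD.
Qed.

(** The weight factorizes: the first value has a truncated geometric law and, given it, the
    renumbered rest is again a Mallows permutation. *)
Lemma mallows_prob_rec (R : realType) (q : R) n (E : 'S_n.+1 -> Prop) : 0 <= q ->
  mallows_prob q E = \sum_(a < n.+1)
    q ^+ a / (\sum_(a < n.+1) q ^+ a) *
    mallows_prob q (fun t => E (lift_perm ord0 a t)).
Proof.
move=> q0; rewrite /mallows_prob big_mkcond sum_perm_lift /=.
apply: eq_bigr => a _; rewrite -big_mkcond big_distrr /=.
apply: eq_bigr => t _; rewrite /mallows_pi -!/(mallows_Z q _).
rewrite mallows_Z_rec Inv_lift_perm exprD.
have := mallows_Z_gt0 _ q n q0; set Z := mallows_Z _ _ => Z0.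
by rewrite invfM mulrACA.
Qed.

Lemma mallows_probT (R : realType) (q : R) n (E : 'S_n -> Prop) : 0 <= q ->
  (forall s, E s) -> mallows_prob q E = 1.
Proof.
move=> q0 ET; rewrite /mallows_prob (eq_bigl xpredT); last by move=> s; apply/asboolP.
by rewrite -mulr_suml divff // gt_eqF // mallows_Z_gt0.
Qed.

Lemma mallows_probC (R : realType) (q : R) n (E : 'S_n -> Prop) : 0 <= q ->
  mallows_prob q (fun s => ~ E s) = 1 - mallows_prob q E.
Proof.
move=> q0; rewrite -(mallows_probT _ q n (fun=> True)) //.
apply/(canRL (addrK _)); rewrite addrC /mallows_prob.
rewrite [RHS](bigID (fun s : 'S_n => `[< E s >])) /=.
congr (_ + _); apply: eq_bigl => s; rewrite [`[< True >]]asboolT //=.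
exact: asbool_neg.
Qed.

(** Values start at 0 here but at 1 in [BST_perm]; the later maps by [succn] bridge the two
    conventions. *)
Definition one_line n (s : 'S_n) : seq nat := [seq (s i : nat) | i <- enum 'I_n].

Lemma one_line_lift n (a : 'I_n.+1) (t : 'S_n) :
  one_line _ (lift_perm ord0 a t) = (a : nat) :: [seq bump a i | i <- one_line _ t].
Proof.
rewrite /one_line enum_ordSl /= lift_perm_id -!map_comp; congr cons.
by apply: eq_map => i /=; rewrite lift_perm_lift.
Qed.

Lemma take_map_bump (a : nat) (x y : seq nat) : a \notin x ->
  take (size x) (map (bump a) y) = x <->
  take (size (map (unbump a) x)) y = map (unbump a) x.
Proof.
move=> ax; rewrite size_map -map_take; split=> [E|->].
  by rewrite -[X in _ = map _ X]E -map_comp map_id_in // => i _ /=; rewrite bumpK.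
rewrite -map_comp map_id_in // => i ix /=; rewrite unbumpKcond.
by rewrite (negbTE (memPn ax _ ix)).
Qed.

(** In [mallows_prob_rec] only the first value [a] can produce this prefix; the remaining entries
    are renumbered to fill the gap left by [a]. *)
Lemma mallows_prob_prefix_rec (R : realType) (q : R) n (a : nat) (x : seq nat) :
  0 <= q -> (a <= n)%N -> a \notin x ->
  mallows_prob q (fun s : 'S_n.+1 => take (size (a :: x)) (one_line _ s) = a :: x) =
  q ^+ a / (\sum_(a < n.+1) q ^+ a) *
  mallows_prob q (fun s : 'S_n => take (size (map (unbump a) x)) (one_line _ s)
    = map (unbump a) x).
Proof.
move=> q0 an ax; rewrite mallows_prob_rec //; set Z := \sum_(a < n.+1) q ^+ a.
rewrite (bigD1 (Ordinal (an : (a < n.+1)%N))) //= big1 ?addr0.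
  congr (_ * _); apply: eq_bigl => t; apply: asbool_equiv_eq.
  rewrite one_line_lift /= -(take_map_bump _ _ _ ax).
  by split=> [[]//|->].
move=> b /eqP ba; rewrite /mallows_prob big_pred0 ?mulr0 // => t.
apply/asboolPn; rewrite one_line_lift /= => -[E _]; apply: ba.
exact/val_inj.
Qed.

Fixpoint noninv (x : seq nat) : nat :=
  if x is a :: x' then (count (ltn a) x' + noninv x')%N else 0%N.

Lemma noninv_rcons x a : noninv (rcons x a) = (noninv x + count (gtn a) x)%N.
Proof.
elim: x => //= b x ->; rewrite -cats1 count_cat /=; lia.
Qed.

Lemma noninv_unbump a x : a \notin x -> noninv (map (unbump a) x) = noninv x.
Proof.
elim: x => //= b x IH; rewrite inE negb_or => /andP[ab ax]; rewrite IH //.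
congr (_ + _)%N; rewrite count_map; apply: eq_in_count => c cx /=.
have := memPn ax _ cx; rewrite /unbump; do 2!case: ltnP; lia.
Qed.

Lemma sumn_unbump a x : a \notin x ->
  (sumn (map (unbump a) x) + count (ltn a) x = sumn x)%N.
Proof.
elim: x => //= b x IH; rewrite inE negb_or => /andP[ab /IH].
rewrite /unbump /=; case: ltnP => /=; lia.
Qed.

(** At most [a] distinct entries are smaller than [a]. This makes the truncated subtraction in
    [sumn x - noninv x] exact. *)
Lemma noninv_le_sumn x : uniq x -> (noninv x <= sumn x)%N.
Proof.
elim/last_ind: x => // x a IH; rewrite rcons_uniq => /andP[ax ux].
rewrite noninv_rcons -cats1 sumn_cat /= addn0 leq_add ?IH //.
rewrite -size_filter -[X in (_ <= X)%N](size_iota 0); apply: uniq_leq_size.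
  exact: filter_uniq.
by move=> y; rewrite mem_filter mem_iota /= add0n => /andP[].
Qed.

(** Entries are peeled off from the front: [a] contributes [q ^+ a * (1 - q)], the limit of its
    truncated geometric weight, and the rest is renumbered. *)
Lemma cvg_mallows_prefix (R : realType) (q : R) (x : seq nat) : 0 <= q -> q < 1 ->
  uniq x ->
  (fun n => mallows_prob q (fun s : 'S_n => take (size x) (one_line _ s) = x))
    @ \oo --> q ^+ (sumn x - noninv x) * (1 - q) ^+ size x.
Proof.
(* Induction is on the length, since the hypothesis is applied to the renumbered tail and not to the
   tail itself. *)
move=> q0 q1; have [m] := ubnP (size x); elim: m x => // m IH [|a x] /=.
  move=> _ _; under eq_fun => n.
    rewrite mallows_probT //; last by move=> s; rewrite take0.
    over.
  by rewrite subnn !expr0 mulr1; exact: cvg_cst.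
rewrite ltnS => xm /andP[ax ux].
set y := map (unbump a) x.
have uy : uniq y.
  rewrite map_inj_in_uniq // => i j ix jx /(congr1 (bump a)).
  rewrite !unbumpKcond.
  by rewrite (negbTE (memPn ax _ ix)) (negbTE (memPn ax _ jx)).
have {IH} := IH y; rewrite size_map => /(_ xm uy) IH.
rewrite -(cvg_shiftS _) /=.
(* Renumbering lowers by one exactly the entries above [a], that is, once per increasing pair
   starting at [a]. *)
have -> : (a + sumn x - (count (ltn a) x + noninv x))%N = (a + (sumn y - noninv y))%N.
  have := noninv_le_sumn _ uy; rewrite -(sumn_unbump _ _ ax) -/y noninv_unbump //; lia.
rewrite exprD exprS mulrACA.
(* The recursion holds once [n] is at least [a], so that the value [a] fits. *)
apply: (@cvg_trans _ ((fun n => q ^+ a / (\sum_(a < n.+1) q ^+ a) *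
   mallows_prob q (fun s : 'S_n => take (size y) (one_line _ s) = y)) @ \oo)).
  apply: near_eq_cvg; near=> n.
  by rewrite -[(size x).+1]/(size (a :: x)) mallows_prob_prefix_rec //; near: n; exists a.
apply: cvgM; last by rewrite size_map.
apply: cvgM; first exact: cvg_cst.
(* The normalizing sums are partial sums of the geometric series, with limit [(1 - q)^-1]. *)
rewrite -[X in _ --> X]invrK; apply: cvgV; first by rewrite invr_neq0 // subr_eq0 gt_eqF.
have := @cvg_geometric_series R 1 q; rewrite ger0_norm // => /(_ q1).
rewrite div1r -(cvg_shiftS _) /=; apply: cvg_trans.
apply: near_eq_cvg; near=> n; rewrite /series /= big_mkord.
by apply: eq_bigr => i _; rewrite mul1r.
Unshelve. all: by end_near. Qed.

(** * Prefixes of the infinite Mallows permutation *)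

Lemma mallows_stepS (x : seq nat) (b : nat -> bool) (a : nat) :
  mallows_step x b = a.+1 <->
  [/\ a.+1 \notin x, b a.+1 &
    forall j, (0 < j < a.+1)%N -> j \notin x -> b j = false].
Proof.
rewrite /mallows_step; case: pselect => [h|nh].
  case: ex_minnP => m /and3P[m0 mx bm] mmin; split=> [E|[ax ba amin]].
    subst m; split=> // j /andP[j0 ja] jx; apply/negbTE/negP => bj.
    by have := mmin j; rewrite j0 jx bj leqNgt ja => /(_ isT).
  apply/eqP; rewrite eqn_leq mmin ?ax //=; rewrite ltnNge; apply/negP => ma.
  by have := amin m; rewrite m0 ltnS ma mx bm => /(_ isT isT).
by split=> // -[ax ba _]; exfalso; apply: nh; exists a.+1; rewrite ax.
Qed.

Lemma mallows_step0 (x : seq nat) (b : nat -> bool) :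
  mallows_step x b = 0%N <-> (forall j, (0 < j)%N -> j \notin x -> b j = false).
Proof.
rewrite /mallows_step; case: pselect => [h|nh].
  case: ex_minnP => m /and3P[m0 mx bm] mmin; split=> [E|/(_ m m0 mx)].
    by rewrite E in m0.
  by rewrite bm.
split=> // _ j j0 jx; apply/negbTE/negP => bj; apply: nh; exists j.
by rewrite j0 jx.
Qed.

Lemma count_notin_iota (y : seq nat) (a : nat) : uniq y ->
  (size [seq j <- iota 0 a | j \notin y] + count (gtn a) y = a)%N.
Proof.
move=> uy; rewrite size_filter -[RHS](size_iota 0) -(count_predC [in y] (iota 0 a)).
rewrite addnC; congr (_ + _)%N; rewrite -!size_filter; apply: perm_size.
apply: uniq_perm; [exact: filter_uniq|exact/filter_uniq/iota_uniq|].
by move=> z; rewrite !mem_filter mem_iota add0n /= andbC.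
Qed.

Lemma mallows_prefix_cells (R : realType) (q : R) (y : seq nat) : uniq y ->
  exists (s : seq (nat * nat)) (b : nat * nat -> bool),
  [/\ uniq s, all (fun p => (0 < p.1)%N && (0 < p.2)%N) s,
    all (fun p => p.1 <= size y)%N s,
    (forall B, mallows_prefix B (size y) = map succn y <->
      forall p, p \in s -> B p.1 p.2 = b p) &
    \prod_(p <- s) (if b p then 1 - q else q) =
      q ^+ (sumn y - noninv y) * (1 - q) ^+ size y].
Proof.
elim/last_ind: y => [|y a IH].
  by move=> _; exists [::], (fun=> true); split=> //; rewrite big_nil expr0 mulr1.
rewrite rcons_uniq => /andP[ay uy]; have [s [b [us ps ls Hs Ps]]] := IH uy.
pose unused := [seq j <- iota 0 a | j \notin y].
pose row := [seq ((size y).+1, j.+1) | j <- rcons unused a].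
exists (s ++ row), (fun p => if (p.1 <= size y)%N then b p else p.2 == a.+1).
have bs p : p \in s -> (p.1 <= size y)%N by move: p; exact/allP.
have brow p : p \in row -> p.1 = (size y).+1 by case/mapP => j _ ->.
split.
- rewrite cat_uniq us /=; apply/andP; split.
    apply/hasPn => p /brow Ep; apply/negP => /bs; by rewrite Ep ltnn.
  rewrite map_inj_uniq; last by move=> j k; case=> ->.
  rewrite rcons_uniq filter_uniq ?iota_uniq // andbT.
  by rewrite mem_filter mem_iota add0n ltnn !andbF.
- by rewrite all_cat ps /=; apply/allP => p /mapP[j _ ->].
- rewrite all_cat size_rcons; apply/andP; split.
    by apply/allP => p /bs /leqW.
  by apply/allP => p /brow ->.
- move=> B; rewrite size_rcons map_rcons /=.
  have rowP : mallows_step (map succn y) (B (size y).+1) = a.+1 <->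
      forall p, p \in row -> B p.1 p.2 = (p.2 == a.+1).
    rewrite mallows_stepS (mem_map succn_inj); split.
      move=> [_ Ba amin] p /mapP[j]; rewrite mem_rcons inE => /orP[/eqP -> ->|].
        by rewrite /= Ba eqxx.
      rewrite mem_filter mem_iota add0n => /andP[jy /andP[_ ja]] -> /=.
      by rewrite amin ?ltnS ?(mem_map succn_inj) // eqSS ltn_eqF.
    move=> H; split=> //.
      by have := H ((size y).+1, a.+1); rewrite eqxx => -> //;
        apply: map_f; rewrite mem_rcons mem_head.
    case=> // j /=; rewrite ltnS (mem_map succn_inj) => ja jy.
    have := H ((size y).+1, j.+1); rewrite /= eqSS ltn_eqF // => -> //.
    by apply: map_f; rewrite mem_rcons inE mem_filter jy mem_iota add0n ja orbT.
  split.
    move=> E; have := E; rewrite -!cats1 => /eqP; rewrite eqseq_cat; last first.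
      by rewrite size_mallows_prefix size_map.
    move=> /andP[/eqP E1 /eqP[]]; rewrite E1 => /rowP E2 p.
    rewrite mem_cat => /orP[ps'|prow]; first by rewrite bs //; exact: (Hs B).1.
    by rewrite (E2 _ prow) (brow _ prow) ltnn.
  move=> H; have E1 : mallows_prefix B (size y) = map succn y.
    by apply/Hs => p ps'; rewrite H ?mem_cat ?ps' // bs.
  rewrite E1; congr rcons; apply/rowP => p prow.
  by rewrite H ?mem_cat ?prow ?orbT // (brow _ prow) ltnn.
rewrite big_cat /=; have -> : \prod_(p <- s) (if if (p.1 <= size y)%N then b p else
     p.2 == a.+1 then 1 - q else q) = \prod_(p <- s) (if b p then 1 - q else q).
  by apply: eq_big_seq => p /bs ->.
rewrite Ps /row big_map /= ltnn -cats1 big_cat big_seq1 /= eqxx.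
rewrite (eq_big_seq (fun=> q)); last first.
  move=> j; rewrite mem_filter mem_iota add0n => /andP[_ /andP[_ ja]].
  by rewrite eqSS ltn_eqF.
rewrite big_const_seq count_predT iter_mulr_1 size_rcons noninv_rcons.
have := count_notin_iota y a uy; rewrite -/unused => Ea.
have -> : (sumn (rcons y a) - (noninv y + count (gtn a) y) =
   (sumn y - noninv y) + size unused)%N.
  have := noninv_le_sumn y uy; rewrite -cats1 sumn_cat /= addn0.
  move: Ea; move: (count _ _) (size _) (sumn y) (noninv y) => c u t v.
  lia.
by rewrite exprD exprS mulrACA [_ * (1 - q)]mulrC.
Qed.

(** * Measurability of events about the infinite tree *)

Lemma measurable_bigcup_countType (d : measure_display) (Omega : measurableType d)
    (T : countType) (D : set T) (F : T -> set Omega) :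
  (forall x, D x -> measurable (F x)) -> measurable (\bigcup_(x in D) F x).
Proof.
move=> mF; rewrite [X in measurable X](_ : _ = \bigcup_k
  (if unpickle k is Some x then if `[< D x >] then F x else set0 else set0)).
  apply: bigcupT_measurable => k; case: unpickle => // x.
  by case: ifP => // /asboolP; exact: mF.
apply/seteqP; split=> w /=.
  by move=> [x Dx Fx]; exists (pickle x) => //; rewrite pickleK asboolT.
by move=> [k _]; case: unpickle => // x; case: ifP => // /asboolP Dx ?; exists x.
Qed.

Section Measurability.
Context (d : measure_display) (Omega : measurableType d).
Variable B : nat -> nat -> Omega -> bool.
Hypothesis B_meas : forall i j, (0 < i)%N -> (0 < j)%N -> measurable [set w | B i j w].

Lemma measurable_entry i j c : (0 < i)%N -> (0 < j)%N ->
  measurable [set w | B i j w = c].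
Proof.
move=> i0 j0; have mB := B_meas _ _ i0 j0; case: c => //.
rewrite [X in measurable X](_ : _ = ~` [set w | B i j w]); first exact: measurableC.
by apply/seteqP; split=> w /=; case: (B i j w).
Qed.

Lemma measurable_entries (C : nat -> bool) (f : nat -> nat * nat) :
  (forall k, C k -> (0 < (f k).1)%N && (0 < (f k).2)%N) ->
  measurable [set w | forall k, C k -> B (f k).1 (f k).2 w = false].
Proof.
move=> f0; rewrite [X in measurable X](_ : _ =
  \bigcap_k (if C k then [set w | B (f k).1 (f k).2 w = false] else setT)).
  apply: bigcapT_measurable => k; case: ifP => // Ck.
  by have /andP[] := f0 _ Ck; exact: measurable_entry.
apply/seteqP; split=> w /= H k; first by move=> _; case: ifP => //; exact: H.
by move=> Ck; have := H k I; rewrite Ck.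
Qed.

Lemma measurable_mallows_step (x : seq nat) i a : (0 < i)%N ->
  measurable [set w | mallows_step x (fun j => B i j w) = a].
Proof.
move=> i0; case: a => [|a].
  have := @measurable_entries (fun j => (0 < j)%N && (j \notin x)) (fun j => (i, j)).
  have /[swap] /[apply] : forall k, (0 < k)%N && (k \notin x) -> (0 < i)%N && (0 < k)%N.
    by move=> k /andP[k0 _]; rewrite i0.
  congr measurable; apply/seteqP; split=> w /=.
    by move=> H; apply/mallows_step0 => j j0 jx; apply: H; rewrite j0.
  by move=> /mallows_step0 H j /andP[]; exact: H.
have := @measurable_entries (fun j => (0 < j < a.+1)%N && (j \notin x)) (fun j => (i, j)).
have /[swap] /[apply] : forall k, (0 < k < a.+1)%N && (k \notin x) ->
    (0 < i)%N && (0 < k)%N.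
  by move=> k /andP[/andP[k0 _] _]; rewrite i0.
move=> m1; have m2 := measurable_entry i a.+1 true i0 isT.
have [ax|ax] := boolP (a.+1 \in x).
  rewrite [X in measurable X](_ : _ = set0) //.
  by apply/seteqP; split=> w //= /mallows_stepS[]; rewrite ax.
rewrite [X in measurable X](_ : _ = [set w | B i a.+1 w = true] `&`
  [set w | forall j, (0 < j < a.+1)%N && (j \notin x) -> B i j w = false]).
  exact: measurableI.
apply/seteqP; split=> w /=.
  by move=> /mallows_stepS[_ ? H]; split=> // j /andP[]; exact: H.
by move=> [? H]; apply/mallows_stepS; split=> // j ja jx; apply: H; rewrite ja.
Qed.

Lemma measurable_mallows_prefix n (x : seq nat) :
  measurable [set w | mallows_prefix (fun i j => B i j w) n = x].
Proof.
elim: n x => [|n IH] x.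
  have [->|/eqP x0] := eqVneq x [::].
    by rewrite [X in measurable X](_ : _ = setT) //; apply/seteqP; split.
  rewrite [X in measurable X](_ : _ = set0) //; apply/seteqP; split=> w //=.
  by move=> E; apply: x0.
case: (lastP x) => [|y a].
  rewrite [X in measurable X](_ : _ = set0) //; apply/seteqP; split=> w //=.
  by move=> /(congr1 size); rewrite size_rcons.
rewrite [X in measurable X](_ : _ =
  [set w | mallows_prefix (fun i j => B i j w) n = y] `&`
  [set w | mallows_step y (fun j => B n.+1 j w) = a]).
  by apply: measurableI => //; exact: measurable_mallows_step.
apply/seteqP; split=> w /= => [/rcons_inj[E]|[E <-]]; last by rewrite E.
by rewrite E => <-.
Qed.

Lemma measurable_BST_inf v :
  measurable [set w | BST_inf (mallows_prefix (fun i j => B i j w)) v].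
Proof.
rewrite [X in measurable X](_ : _ = \bigcup_n \bigcup_(x in [set x | inBST x v])
  [set w | mallows_prefix (fun i j => B i j w) n = x]).
  apply: bigcupT_measurable => n; apply: measurable_bigcup_countType => x _.
  exact: measurable_mallows_prefix.
apply/seteqP; split=> w /=.
  move=> [n nv]; exists n => //.
  by exists (mallows_prefix (fun i j => B i j w) n).
by move=> [n _ [x xv /= E]]; exists n; rewrite E.
Qed.

(** Such a property is determined by the membership bits of the finitely many words of length at
    most [r], and there are countably many bit lists. *)
Lemma measurable_local (Q : (seq bool -> Prop) -> Prop) r :
  (forall G G', agree r G G' -> Q G -> Q G') ->
  measurable [set w | Q (BST_inf (mallows_prefix (fun i j => B i j w)))].
Proof.
move=> Qloc; pose T w := BST_inf (mallows_prefix (fun i j => B i j w)).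
have mW (s : seq (seq bool)) (b : bitseq) :
    measurable [set w | [seq `[< T w v >] | v <- s] = b].
  elim: s b => [|v s IH] b.
    case: b => [|c b].
      by rewrite [X in measurable X](_ : _ = setT) //; apply/seteqP; split.
    by rewrite [X in measurable X](_ : _ = set0) //; apply/seteqP; split.
  case: b => [|c b].
    by rewrite [X in measurable X](_ : _ = set0) //; apply/seteqP; split.
  rewrite [X in measurable X](_ : _ = [set w | `[< T w v >] = c] `&`
     [set w | [seq `[< T w v >] | v <- s] = b]); last first.
    by apply/seteqP; split=> w /=; [case|case=> -> ->].
  apply: measurableI => //; have mv := measurable_BST_inf v; case: c.
    congr measurable: mv; apply/seteqP; split=> w /= /asboolP //.
  rewrite [X in measurable X](_ : _ = ~` [set w | T w v]); first exact: measurableC.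
  by apply/seteqP; split=> w /=; [move/negbT/asboolPn|move/asboolPn/negbTE].
(* [G b] rebuilds a tree from a bit list; only its values at depth at most [r] are meant to be
   read. *)
pose G (b : bitseq) v : Prop := nth false b (index v (words r)).
rewrite [X in measurable X](_ : _ = \bigcup_(b in [set b | Q (G b)])
  [set w | [seq `[< T w v >] | v <- words r] = b]).
  exact: measurable_bigcup_countType.
have TG w : agree r (T w) (G [seq `[< T w v >] | v <- words r]).
  move=> v vr; rewrite /G (nth_map [::]) ?index_mem ?mem_words // nth_index ?mem_words //.
  by split=> [?|/asboolP//]; exact/asboolP.
apply/seteqP; split=> w /=.
  by move=> Qw; exists [seq `[< T w v >] | v <- words r] => //; exact: Qloc _ _ (TG w) Qw.
by move=> [b Qb /= E]; apply: (Qloc _ _ _ Qb); rewrite -E; exact/agree_sym/TG.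
Qed.

End Measurability.

(** * Finite-dimensional law of the bits, and finite parts of countable covers *)

Definition iid_bernoulli {R : realType} (q : R) {d : measure_display}
    {Omega : measurableType d} (P : probability Omega R)
    (B : nat -> nat -> Omega -> bool) :=
  forall (s : seq (nat * nat)) (b : nat * nat -> bool),
    uniq s -> all (fun p => (0 < p.1)%N && (0 < p.2)%N) s ->
    P (\big[setI/setT]_(p <- s) [set w : Omega | B p.1 p.2 w = b p])%classic =
    ((\prod_(p <- s) (if b p then 1 - q else q))%R)%:E.

Lemma bigsetI_seq (T : Type) (I : eqType) (s : seq I) (F : I -> set T) :
  \big[setI/setT]_(i <- s) F i = [set w | forall i, i \in s -> F i w].
Proof.
elim: s => [|i s IH]; first by rewrite big_nil; apply/seteqP; split.
rewrite big_cons IH; apply/seteqP; split=> w /=.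
  by move=> [Fi Fs] j; rewrite inE => /orP[/eqP ->|/Fs].
move=> H; split=> [|j js]; apply: H; rewrite inE ?eqxx //.
by rewrite js orbT.
Qed.

(** By subadditivity the series of cover probabilities is at least [P A]; were every finite sum at
    most [P A - eps], so would be its limit. *)
Lemma countable_cover_finite (R : realType) (d : measure_display)
    (Omega : measurableType d) (P : probability Omega R) (T : countType)
    (D : pred T) (F : T -> set Omega) (A : set Omega) (eps : R) :
  measurable A -> (forall x, D x -> measurable (F x)) ->
  A `<=` \bigcup_(x in [set x | D x]) F x -> 0 < eps ->
  exists s : seq T, [/\ uniq s, all D s &
    fine (P A) - eps <= \sum_(x <- s) fine (P (F x))].
Proof.
move=> mA mF AF eps0.
pose h x := if D x then F x else set0.
(* [pickle_inv] accepts only the canonical code of each element, so the list [s K] read off the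
   first [K] codes has no repetition. *)
pose G k := oapp h set0 (@pickle_inv T k).
have mh x : measurable (h x) by rewrite /h; case: ifP => // /mF.
have mG k : measurable (G k) by rewrite /G; case: pickle_inv => [x|] //=.
have PAG : (P A <= \sum_(0 <= k <oo) P (G k))%E.
  apply: measure_sigma_subadditive => //= w /AF[x Dx Fx].
  by exists (pickle x) => //; rewrite /G pickleK_inv /= /h Dx.
pose s K := [seq x <- pmap (@pickle_inv T) (iota 0 K) | D x].
have sE K : (\sum_(0 <= k < K) P (G k) = (\sum_(x <- s K) fine (P (F x)))%:E)%E.
  rewrite -sumEFin /s big_filter [RHS]big_mkcond big_pmap /index_iota subn0.
  apply: eq_bigr => k _; rewrite /G; case: pickle_inv => [x|] /=.
    rewrite /h; case: ifP => [Dx|_]; last exact: measure0.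
    by rewrite fineK // fin_num_measure //; exact: mF.
  exact: measure0.
apply: contrapT => ns.
have sK K : (\sum_(0 <= k < K) P (G k) <= (fine (P A) - eps)%:E)%E.
  rewrite sE lee_fin leNgt; apply/negP => /ltW H; apply: ns; exists (s K).
  split=> //; last by apply/allP => x; rewrite mem_filter => /andP[].
  by apply: filter_uniq; apply: pmap_uniq (iota_uniq 0 K); exact: pickle_invK.
have : (P A <= (fine (P A) - eps)%:E)%E.
  apply: (le_trans PAG); apply: lime_le; last exact: nearW.
  by apply: is_cvg_nneseries => *; exact: measure_ge0.
rewrite -[X in (X <= _)%E]fineK ?fin_num_measure // lee_fin.
by rewrite lerBrDl gerDr leNgt eps0.
Qed.

(** * Minimal deciding sequences and the limit *)

Definition min_deciding r (x : seq nat) :=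
  [/\ proper_seq x, decides_upto r x &
    forall k, (k < size x)%N -> ~ decides_upto r (take k x)].

(** Two such prefixes of the same [z] are nested, and minimality forbids the longer one a strictly
    shorter deciding prefix. *)
Lemma min_deciding_prefix r (x y z : seq nat) :
  min_deciding r x -> min_deciding r y ->
  take (size x) z = x -> take (size y) z = y -> x = y.
Proof.
wlog xy : x y / (size x <= size y)%N.
  move=> H mx my zx zy; have [xy|/ltnW yx] := leqP (size x) (size y).
    exact: H.
  by symmetry; exact: H.
move=> [_ dx _] [_ _ my] zx zy.
have E : take (size x) y = x by rewrite -zy -[RHS]zx take_takel.
move: xy; rewrite leq_eqVlt => /orP[/eqP xy|/my]; last by rewrite E.
by rewrite -E xy take_size.
Qed.

Lemma min_deciding_exists B r : good_array B ->
  exists m, min_deciding r (mallows_prefix B m).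
Proof.
move=> gB; have [m0 d0] := mallows_decides_upto B r gB.
have : exists m, `[< decides_upto r (mallows_prefix B m) >] by exists m0; exact/asboolP.
move=> /ex_minnP[m /asboolP dm mmin]; exists m; split=> //.
  exact: proper_mallows_prefix.
move=> k; rewrite size_mallows_prefix => km dk.
have := mmin k; rewrite leqNgt km => H.
have : ~~ true by apply: H; apply/asboolP; rewrite (mallows_prefix_take _ _ _ (ltnW km)).
by [].
Qed.

Lemma proper_succ x : proper_seq x -> exists2 y, uniq y & x = map succn y.
Proof.
move=> /andP[ux /allP px]; have E : x = map succn (map predn x).
  rewrite -map_comp map_id_in // => i /px /=; exact: prednK.
by exists (map predn x) => //; rewrite -(map_inj_uniq succn_inj) -E.
Qed.

Lemma BST_permE n (s : 'S_n) :
  BST_perm s = inBST (map succn (one_line n s)) :> (seq bool -> Prop).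
Proof. by rewrite /BST_perm /one_line -map_comp. Qed.

Lemma uniq_one_line n (s : 'S_n) : uniq (one_line n s).
Proof.
rewrite map_inj_uniq ?enum_uniq // => i j /val_inj; exact: perm_inj.
Qed.

Lemma agree_BST_perm r n (s : 'S_n) y :
  decides_upto r (map succn y) -> take (size y) (one_line n s) = y ->
  agree r (inBST (map succn y)) (BST_perm s).
Proof.
move=> dy Ey w wr; rewrite BST_permE.
have E : map succn (one_line n s) =
    map succn y ++ map succn (drop (size y) (one_line n s)).
  by rewrite -map_cat -{1}Ey cat_take_drop.
rewrite E dy // -E /proper_seq map_inj_uniq; last exact: succn_inj.
by rewrite uniq_one_line; apply/allP => i /mapP[j _ ->].
Qed.

(** After exchanging sums, a permutation is charged once per [y] in [s] that it starts with. By
    minimality there is at most one, and a deciding [y] carries [Q] over to [BST_perm t]. *)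
Lemma sum_mallows_prefix_le (R : realType) (q : R) n
    (Q : (seq bool -> Prop) -> Prop) r (s : seq (seq nat)) : 0 <= q ->
  (forall G G', agree r G G' -> Q G -> Q G') -> uniq s ->
  (forall y, y \in s -> min_deciding r (map succn y) /\ Q (inBST (map succn y))) ->
  \sum_(y <- s) mallows_prob q (fun t : 'S_n => take (size y) (one_line n t) = y)
    <= mallows_prob q (fun t : 'S_n => Q (BST_perm t)).
Proof.
move=> q0 Qloc us sQ; rewrite /mallows_prob.
under eq_bigr do rewrite big_mkcond.
rewrite exchange_big /= [leRHS]big_mkcond; apply: ler_sum => t _.
have pi0 : 0 <= mallows_pi q t.
  by rewrite divr_ge0 ?exprn_ge0 //; exact/ltW/mallows_Z_gt0.
rewrite -big_mkcond big_const_seq iter_addr_0.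
set M := fun y => _; case E : [seq y <- s | M y] => [|y0 s0].
  by rewrite -size_filter E mulr0n; case: ifP.
have : y0 \in [seq y <- s | M y] by rewrite E mem_head.
rewrite mem_filter => /andP[/asboolP y0t y0s].
have [my0 Qy0] := sQ _ y0s; have [_ dy0 _] := my0.
rewrite asboolT; last exact: Qloc _ _ (agree_BST_perm _ _ _ _ dy0 y0t) Qy0.
rewrite -[leRHS]mulr1n; apply: ler_wpMn2l => //.
rewrite -size_filter; apply: (@uniq_leq_size _ _ [:: y0]) (filter_uniq _ us) _ => y.
rewrite mem_filter inE => /andP[/asboolP yt ys]; have [my _] := sQ _ ys.
apply/eqP/(inj_map succn_inj)/(min_deciding_prefix r _ _ (map succn (one_line n t))).
- exact: my.
- exact: my0.
- by rewrite size_map -map_take yt.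
- by rewrite size_map -map_take y0t.
Qed.

Section Limit.
Context (R : realType) (q : R) (hq0 : 0 <= q) (hq1 : q < 1).
Context (d : measure_display) (Omega : measurableType d) (P : probability Omega R).
Variable B : nat -> nat -> Omega -> bool.
Hypothesis B_meas : forall i j, (0 < i)%N -> (0 < j)%N -> measurable [set w | B i j w].
Hypothesis B_iid : iid_bernoulli q P B.

Let prefix w := mallows_prefix (fun i j => B i j w).

Lemma prob_mallows_prefix (y : seq nat) : uniq y ->
  P [set w | prefix w (size y) = map succn y] =
  (q ^+ (sumn y - noninv y) * (1 - q) ^+ size y)%:E.
Proof.
move=> uy; have [s [b [us ps _ Hs <-]]] := mallows_prefix_cells R q y uy.
rewrite -B_iid //; congr (P _); rewrite bigsetI_seq.
by apply/seteqP; split=> w /=; case: (Hs (fun i j => B i j w)).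
Qed.

(** The first [K] cells all fail with probability [q ^+ K], which tends to 0. *)
Lemma negligible_no_success (f : nat -> nat * nat) : injective f ->
  (forall k, (0 < (f k).1)%N && (0 < (f k).2)%N) ->
  P.-negligible [set w | forall k, B (f k).1 (f k).2 w = false].
Proof.
move=> injf f0; set A := [set w | _].
have mA : measurable A.
  have := measurable_entries _ _ B B_meas xpredT f (fun k _ => f0 k).
  by congr measurable; apply/seteqP; split=> w /= H k //; exact: H.
apply/negligibleP => //; apply/eqP; rewrite -measure_le0.
have AK K : (P A <= (q ^+ K)%:E)%E.
  have -> : q ^+ K = \prod_(p <- map f (iota 0 K)) (if false then 1 - q else q).
    by rewrite big_map big_const_seq count_predT size_iota iter_mulr_1.
  rewrite -(B_iid _ (fun=> false)); last 2 first.
  - by rewrite map_inj_uniq // iota_uniq.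
  - by apply/allP => p /mapP[k _ ->].
  apply: le_measure; rewrite ?inE //.
    rewrite big_map; apply: bigsetI_measurable => k _.
    by have /andP[? ?] := f0 k; exact: measurable_entry.
  by rewrite bigsetI_seq => w Aw p /mapP[k _ ->]; exact: Aw.
have cq : (fun K => (q ^+ K)%:E) @ \oo --> 0%:E.
  by apply: cvg_EFin; [exact: nearW|apply: cvg_expr; rewrite ger0_norm].
by apply: cvge_ge cq; exact: nearW.
Qed.

Lemma negligible_not_good :
  P.-negligible [set w | ~ good_array (fun i j => B i j w)].
Proof.
(* If the array is not good, some row or column has no success beyond some [N]; there are countably
   many such tails, each negligible. *)
have row i N := negligible_no_success (fun k => (i.+1, (N + k).+1)).
have col j N := negligible_no_success (fun k => ((N + k).+1, j.+1)).
apply: (@negligibleS _ _ _ _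
   (\bigcup_i \bigcup_N [set w | forall k, B i.+1 (N + k).+1 w = false] `|`
    \bigcup_j \bigcup_N [set w | forall k, B (N + k).+1 j.+1 w = false])).
  move=> w /= ng; apply: contrapT => /not_orP[nr nc]; apply: ng; split.
    case=> // i N _; apply: contrapT => H; apply: nr; exists i => //; exists N => // k.
    apply/negbTE/negP => Bk; apply: H; exists (N + k).+1 => //.
    by rewrite ltnS leq_addr.
  case=> // j N _; apply: contrapT => H; apply: nc; exists j => //; exists N => // k.
  apply/negbTE/negP => Bk; apply: H; exists (N + k).+1 => //.
  by rewrite ltnS leq_addr.
apply: negligibleU; apply: negligible_bigcup => i; apply: negligible_bigcup => N.
  by apply: row => // k l [] /addnI.
by apply: col => // k l [] /addnI.
Qed.

Lemma mallows_liminf (Q : (seq bool -> Prop) -> Prop) r (eps : R) :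
  (forall G G', agree r G G' -> Q G -> Q G') -> 0 < eps ->
  \forall n \near \oo, fine (P [set w | Q (BST_inf (prefix w))]) - eps <=
    mallows_prob q (fun t : 'S_n => Q (BST_perm t)).
Proof.
move=> Qloc eps0; set A := [set w | _].
have mA : measurable A by exact: (measurable_local _ _ _ B_meas Q r Qloc).
have [N [mN N0 subN]] := negligible_not_good.
pose D y := `[< [/\ uniq y, min_deciding r (map succn y) & Q (inBST (map succn y))] >].
pose F (y : seq nat) := [set w | prefix w (size y) = map succn y].
have mF y : measurable (F y) by exact: measurable_mallows_prefix.
(* Off the null set [N] the array is good, so a minimal deciding prefix exists, and its tree
   inherits [Q] by locality. *)
have AF : A `\` N `<=` \bigcup_(y in [set y | D y]) F y.
  move=> w [Aw Nw]; have gB : good_array (fun i j => B i j w).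
    by apply: contrapT => /subN.
  have [m md] := min_deciding_exists _ r gB; have [pm dm _] := md.
  have [y uy Ey] := proper_succ _ pm; exists y; last first.
    by rewrite /F /= -Ey /prefix -(size_map succn) -Ey size_mallows_prefix.
  apply/asboolP; split; rewrite -?Ey //.
  exact: Qloc _ _ (agree_BST_inf _ _ _ gB dm) Aw.
have PAN : P A = P (A `\` N).
  have mAN := measurableD mA mN; apply/eqP; rewrite eq_le; apply/andP; split.
    rewrite -(measureU0 mAN mN N0); apply: le_measure; rewrite ?inE //.
      exact: measurableU.
    by move=> w Aw; have [?|?] := pselect (N w); [right|left].
  by apply: le_measure; rewrite ?inE // => w [].
(* Half of [eps] is lost to the finite cover; the other half leaves a strict inequality, so the
   converging sums eventually exceed the bound. *)
have e2 : 0 < eps / 2 by rewrite divr_gt0.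
have [s [us /allP sD sA]] := countable_cover_finite _ _ _ P _ D F _ _
  (measurableD mA mN) (fun y _ => mF y) AF e2.
have {}sD y : y \in s -> [/\ uniq y, min_deciding r (map succn y)
    & Q (inBST (map succn y))] by move=> /sD/asboolP.
have cs : (fun n => \sum_(y <- s)
    mallows_prob q (fun t : 'S_n => take (size y) (one_line n t) = y))
    @ \oo --> \sum_(y <- s) fine (P (F y)).
  elim: s us sD {sA} => [|y s IH] /= us sD.
    by under eq_fun do rewrite big_nil; rewrite big_nil; exact: cvg_cst.
  under eq_fun do rewrite big_cons; rewrite big_cons.
  have [uy _ _] := sD y (mem_head _ _).
  apply: cvgD; first by rewrite prob_mallows_prefix //; exact: cvg_mallows_prefix.
  apply: IH => [|z zs]; first by case/andP: us.
  by apply: sD; rewrite inE zs orbT.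
have lt_s : fine (P A) - eps < \sum_(y <- s) fine (P (F y)).
  by apply: lt_le_trans sA; rewrite PAN; lra.
near=> n; apply: (@le_trans _ _ (\sum_(y <- s)
    mallows_prob q (fun t : 'S_n => take (size y) (one_line n t) = y))).
  by near: n; exact: cvgr_ge cs _ lt_s.
by apply: sum_mallows_prefix_le Qloc us _ => // y /sD[].
Unshelve. all: by end_near. Qed.

End Limit.

Theorem theorem1p3
  (R : realType) (q : R) (hq0 : (0 <= q)%R) (hq1 : (q < 1)%R)
  (d : measure_display) (Omega : measurableType d) (P : probability Omega R)
  (B : nat -> nat -> Omega -> bool)
  (B_meas : forall i j, (0 < i)%N -> (0 < j)%N -> measurable [set w | B i j w])
  (B_iid : forall (s : seq (nat * nat)) (b : nat * nat -> bool),
      uniq s -> all (fun p => (0 < p.1)%N && (0 < p.2)%N) s ->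
      P (\big[setI/setT]_(p <- s) [set w : Omega | B p.1 p.2 w = b p])%classic =
      ((\prod_(p <- s) (if b p then 1 - q else q))%R)%:E)
  (r : nat) (hr : (1 <= r)%N)
  (V : finType) (e : rel V) (v0 : V) (htree : is_tree e) :
  (fun n => (mallows_prob q (fun s : 'S_n => ball_iso (BST_perm s) r e v0))%:E)
    @ \oo -->
  P [set w : Omega | ball_iso (BST_inf (mallows_prefix (fun i j => B i j w))) r e v0].
Proof.
pose Q G := ball_iso G r e v0.
have Qloc G G' : agree r G G' -> Q G -> Q G'.
  by move=> GG'; rewrite /Q (ball_iso_agree _ _ _ _ _ _ GG').
have QClocal G G' : agree r G G' -> ~ Q G -> ~ Q G'.
  by move=> GG'; rewrite /Q (ball_iso_agree _ _ _ _ _ _ GG').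
have mA := measurable_local _ _ _ B_meas Q r Qloc.
set A := [set w | _] in mA *.
rewrite -[P A]fineK ?fin_num_measure //; apply: cvg_EFin; first exact: nearW.
apply/cvgrPdist_le => eps eps0; near=> n; rewrite /= ler_distl.
have lower : fine (P A) - eps <= mallows_prob q (fun t : 'S_n => Q (BST_perm t)).
  near: n; exact: (mallows_liminf _ _ hq0 hq1 _ _ P _ B_meas B_iid Q r).
(* The complementary property is local too; its lower bound, subtracted from 1, is the upper bound
   for [Q]. *)
have upper : fine (P (~` A)) - eps <= mallows_prob q (fun t : 'S_n => ~ Q (BST_perm t)).
  near: n; exact: (mallows_liminf _ _ hq0 hq1 _ _ P _ B_meas B_iid (fun G => ~ Q G) r).
move: upper; rewrite mallows_probC // probability_setC // fineB ?fin_num_measure //=.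
rewrite /Q in lower * => upper; lra.
Unshelve. all: by end_near. Qed.
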